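(* There is no functor $M:\mathfrak{H}\to\mathfrak{H}$ such that $M(G)=d(G)$ for all set-system hypergraphs $G$.
   Context: $\mathcal{P}$ denotes the covariant power-set functor on sets, with $\mathcal P(f)(A)=\{f(x):x\in A\}$. A set-system hypergraph is a triple $G=(E(G),\epsilon_G,V(G))$, where $E(G)$ (edges) and $V(G)$ (vertices) are sets and $\epsilon_G:E(G)\to\mathcal P(V(G))$ is a function. The category $\mathfrak H$ has set-system hypergraphs as objects; a morphism $\phi:G\to H$ is a pair of functions $E(\phi):E(G)\to E(H)$, $V(\phi):V(G)\to V(H)$ with $\epsilon_H(E(\phi)(e))=\mathcal P(V(\phi))(\epsilon_G(e))$ for all $e\in E(G)$. Dual hypergraph: for a set-system hypergraph $G$, $d(G)$ is the set-system hypergraph with vertex set $V(d(G))=E(G)$, edge set $E(d(G))=V(G)$, and $\epsilon_{d(G)}(v)=\{e\in E(G):v\in\epsilon_G(e)\}$. *)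

(* Defs.v *)
From mathcomp Require Import all_boot.
From mathcomp Require Import boolp classical_sets.

Set Implicit Arguments.
Unset Strict Implicit.
Unset Printing Implicit Defensive.

Local Open Scope classical_set_scope.

Record category := Category {
  obj :> Type;
  hom : obj -> obj -> Type;
  idm : forall a : obj, hom a a;
  compm : forall a b c : obj, hom b c -> hom a b -> hom a c;
  compm1 : forall (a b : obj) (f : hom a b), compm f (idm a) = f;
  comp1m : forall (a b : obj) (f : hom a b), compm (idm b) f = f;
  compmA : forall (a b c d : obj) (h : hom c d) (g : hom b c) (f : hom a b),
    compm h (compm g f) = compm (compm h g) f
}.

Record functor (C D : category) := Functor {
  fobj :> C -> D;
  fmap : forall a b : C, hom a b -> hom (fobj a) (fobj b);
  fmap1 : forall a : C, fmap (idm a) = idm (fobj a);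
  fmap_comp : forall (a b c : C) (g : hom b c) (f : hom a b),
    fmap (compm g f) = compm (fmap g) (fmap f)
}.

(* Sets are types, and the power set of [T] is [set T]; the covariant
   power-set functor acts on a function [f] by direct image [f @` _]. *)
Record hypergraph := Hypergraph {
  edge : Type;
  vertex : Type;
  ends : edge -> set vertex
}.

Record hypergraph_hom (G H : hypergraph) := HypergraphHom {
  edge_map : edge G -> edge H;
  vertex_map : vertex G -> vertex H;
  ends_map : forall e : edge G, ends (edge_map e) = vertex_map @` ends e
}.

Lemma hypergraph_hom_eq (G H : hypergraph) (f g : hypergraph_hom G H) :
  edge_map f = edge_map g -> vertex_map f = vertex_map g -> f = g.
Proof.
case: f g => [fe fv fP] [ge gv gP] /= eq_e eq_v.
by case: _ / eq_e gP; case: _ / eq_v => gP; rewrite (Prop_irrelevance fP gP).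
Qed.

Lemma hypergraph_id_subproof (G : hypergraph) (e : edge G) :
  ends (id e) = id @` ends e.
Proof. by rewrite image_id. Qed.

Definition hypergraph_id (G : hypergraph) : hypergraph_hom G G :=
  HypergraphHom (@hypergraph_id_subproof G).

Lemma hypergraph_comp_subproof (G H K : hypergraph)
    (g : hypergraph_hom H K) (f : hypergraph_hom G H) (e : edge G) :
  ends ((edge_map g \o edge_map f) e) =
  (vertex_map g \o vertex_map f) @` ends e.
Proof. by rewrite /= !ends_map image_comp. Qed.

Definition hypergraph_comp (G H K : hypergraph)
    (g : hypergraph_hom H K) (f : hypergraph_hom G H) : hypergraph_hom G K :=
  HypergraphHom (hypergraph_comp_subproof g f).

Lemma hypergraph_compm1 (G H : hypergraph) (f : hypergraph_hom G H) :
  hypergraph_comp f (hypergraph_id G) = f.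
Proof. exact: hypergraph_hom_eq. Qed.

Lemma hypergraph_comp1m (G H : hypergraph) (f : hypergraph_hom G H) :
  hypergraph_comp (hypergraph_id H) f = f.
Proof. exact: hypergraph_hom_eq. Qed.

Lemma hypergraph_compmA (G H K L : hypergraph) (h : hypergraph_hom K L)
    (g : hypergraph_hom H K) (f : hypergraph_hom G H) :
  hypergraph_comp h (hypergraph_comp g f) =
  hypergraph_comp (hypergraph_comp h g) f.
Proof. exact: hypergraph_hom_eq. Qed.

Definition hypergraph_category : category :=
  Category hypergraph_compm1 hypergraph_comp1m hypergraph_compmA.

Definition dual (G : hypergraph) : hypergraph :=
  Hypergraph (fun v : vertex G => [set e : edge G | ends e v]).

(* Main.v *)
Require Import Defs.
From mathcomp Require Import all_boot.
From mathcomp Require Import boolp classical_sets.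

Set Implicit Arguments.
Unset Strict Implicit.
Unset Printing Implicit Defensive.

Local Open Scope classical_set_scope.

(** Adding an edge through an isolated vertex [v] gives a morphism [G -> H].
    In [dual G] the vertex [v] becomes an edge with no ends, whose image under
    any morphism again has no ends; but [dual H] has no such edge. *)

Definition isolated_vertex : hypergraph :=
  Hypergraph (fun _ : void => [set: unit]).

Definition vertex_with_loop : hypergraph :=
  Hypergraph (fun _ : unit => [set: unit]).

Lemma add_loop_subproof (e : edge isolated_vertex) :
  ends (of_void (edge vertex_with_loop) e) = id @` ends e.
Proof. by case: e. Qed.

Definition add_loop : hypergraph_hom isolated_vertex vertex_with_loop :=
  HypergraphHom add_loop_subproof.

Lemma no_dual_hom :
  hypergraph_hom (dual isolated_vertex) (dual vertex_with_loop) -> False.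
Proof.
move=> f.
(* Whatever vertex [edge_map f tt] is, the loop contains it: membership reduces to [[set: unit]],
   which holds by computation. *)
have : ends (edge_map f tt) tt by [].
(* A preimage of [tt] under [vertex_map f] would be an edge of [isolated_vertex], an element of
   [void]. *)
by rewrite ends_map => -[[]].
Qed.

Theorem proposition2p15 :
  ~ (exists M : functor hypergraph_category hypergraph_category,
       forall G : hypergraph, fobj M G = dual G).
Proof.
move=> [M dualM].
have := @fmap _ _ M isolated_vertex vertex_with_loop add_loop.
(* The equalities on objects turn the type of the image of [add_loop] into one of morphisms between
   the duals. *)
by rewrite !dualM => /no_dual_hom.
Qed.
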